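(* Let $K$ be a subfield of $\mathbb{R}$ and let $D\subseteq K$ be a discrete set. Then there is a discrete set $E\subseteq K$ such that $E$ is closed in $\mathbb{R}$ (i.e. closed in the order topology of $\mathbb{R}$), the structures $(K,D)$ and $(K,E)$ are interdefinable, and there is a surjection $g:E\to D$ definable in $(K,D)$.
   Context: $K$ is regarded as an ordered field with the order induced from $\mathbb{R}$; $(K,D)$ denotes the expansion of this ordered field by a unary predicate for $D$. Definable means definable with parameters. Two expansions are interdefinable if each of $D$, $E$ is definable in the other structure. A set is discrete if each of its points is isolated. *)

(* Defs.v *)
From HB Require Import structures.
From mathcomp Require Import all_boot all_order all_algebra.
From mathcomp Require Import all_classical all_reals all_analysis.

Set Implicit Arguments.
Unset Strict Implicit.
Unset Printing Implicit Defensive.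

Import Order.TTheory GRing.Theory Num.Theory.
Import numFieldNormedType.Exports.

Local Open Scope classical_set_scope.
Local Open Scope ring_scope.

(* Formulas in the language of ordered fields with one extra unary predicate,
   with parameters from A.  [formula A n] has its free variables among 'I_n; a
   quantifier binds variable 0 of its body (de Bruijn indices). *)
Inductive term (A : Type) (n : nat) : Type :=
| TVar of 'I_n
| TParam of A
| TZero
| TOne
| TAdd of term A n & term A n
| TOpp of term A n
| TMul of term A n & term A n.

Inductive formula (A : Type) (n : nat) : Type :=
| FEq of term A n & term A n
| FLt of term A n & term A n
| FPred of term A n
| FNot of formula A n
| FAnd of formula A n & formula A n
| FOr of formula A n & formula A n
| FExists of formula A n.+1
| FForall of formula A n.+1.

Definition scons (A : Type) (n : nat) (a : A) (e : 'I_n -> A) : 'I_n.+1 -> A :=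
  fun i => if unlift ord0 i is Some j then e j else a.

(* When K is a subfield of R, the value of a term lies in K, so computing it in
   R agrees with computing it in the field K. *)
Fixpoint eval (R : realType) (K : set R) (n : nat) (e : 'I_n -> K)
    (t : term K n) : R :=
  match t with
  | TVar i => val (e i)
  | TParam c => val c
  | TZero => 0
  | TOne => 1
  | TAdd t1 t2 => eval e t1 + eval e t2
  | TOpp t1 => - eval e t1
  | TMul t1 t2 => eval e t1 * eval e t2
  end.

(* Satisfaction in the structure (K, D): quantifiers range over K. *)
Fixpoint sat (R : realType) (K D : set R) (n : nat) (e : 'I_n -> K)
    (f : formula K n) : Prop :=
  match f with
  | FEq t1 t2 => eval e t1 = eval e t2
  | FLt t1 t2 => eval e t1 < eval e t2
  | FPred t => D (eval e t)
  | FNot g => ~ sat D e g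
  | FAnd g h => sat D e g /\ sat D e h
  | FOr g h => sat D e g \/ sat D e h
  | FExists g => exists a : K, sat D (scons a e) g
  | FForall g => forall a : K, sat D (scons a e) g
  end.

Definition definable (R : realType) (K D : set R) (n : nat)
    (X : set ('I_n -> K)) : Prop :=
  exists f : formula K n, forall x : 'I_n -> K, X x <-> sat D x f.

Definition definable_set (R : realType) (K D X : set R) : Prop :=
  definable D [set x : 'I_1 -> K | X (val (x ord0))].

Definition interdefinable (R : realType) (K D E : set R) : Prop :=
  definable_set K D E /\ definable_set K E D.

(* g is only considered on its domain E; its values elsewhere are irrelevant. *)
Definition definable_fun (R : realType) (K D E : set R) (g : R -> R) : Prop :=
  definable D [set x : 'I_2 -> K |
    E (val (x ord0)) /\ val (x ord_max) = g (val (x ord0))].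

Definition discrete_set (T : topologicalType) (A : set T) : Prop :=
  A `<=` isolated A.

(* Main.v *)
Require Import Defs.
From HB Require Import structures.
From mathcomp Require Import all_boot all_order all_algebra.
From mathcomp Require Import all_classical all_reals all_analysis.
From mathcomp Require Import lra.

Import Order.TTheory GRing.Theory Num.Theory.
Import numFieldNormedType.Exports.

Local Open Scope classical_set_scope.
Local Open Scope ring_scope.

Set Implicit Arguments.
Unset Strict Implicit.
Unset Printing Implicit Defensive.

(* Call a set locally finite if its intersection with every bounded interval is
   finite; such sets are closed and discrete, and if D is locally finite then
   E = D works.  Otherwise let D_t be the set of points of D lying in [-t, t]
   and at distance at least 1/t from the rest of D.  The D_t are finite, increase
   with t and exhaust D.  Let F be the set of reciprocals of the least gaps of the
   D_t with t in K.  Since some bounded interval contains infinitely many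
   points of D, these gaps tend to 0, so F is an unbounded locally finite subset
   of K.  For consecutive y < w in F, place an affine copy of D_y inside [y, w);
   E is the union of -F and of all these copies.  The negative part of E gives
   back F, hence the affine maps, hence D, and undoing them is the
   surjection. *)

(** * Closure properties of definable sets *)

(** Terms are handled through the functions they denote, so that definability can be read off the
    shape of a set comprehension. *)
Definition term_fun (R : realType) (K : set R) (n : nat)
    (u : ('I_n -> K) -> R) : Prop :=
  exists t : term K n, forall x, Defs.eval x t = u x.

Lemma scons0 (A : Type) (n : nat) (a : A) (x : 'I_n -> A) :
  scons a x ord0 = a.
Proof. by rewrite /scons unlift_none. Qed.

Lemma sconsS (A : Type) (n : nat) (a : A) (x : 'I_n -> A) (i : 'I_n) :
  scons a x (lift ord0 i) = x i.
Proof. by rewrite /scons liftK. Qed.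

Lemma reindex_eval (R : realType) (K : set R) (m n : nat) (r : 'I_m -> 'I_n)
    (t : term K m) :
  exists t' : term K n, forall x, Defs.eval x t' = Defs.eval (x \o r) t.
Proof.
elim: t => [i|c|||t1 [t1' h1] t2 [t2' h2]|t1 [t1' h1]|t1 [t1' h1] t2 [t2' h2]].
- by exists (TVar _ (r i)).
- by exists (TParam _ c).
- by exists (TZero _ _).
- by exists (TOne _ _).
- by exists (TAdd t1' t2') => x /=; rewrite h1 h2.
- by exists (TOpp t1') => x /=; rewrite h1.
- by exists (TMul t1' t2') => x /=; rewrite h1 h2.
Qed.

Lemma reindex_sat (R : realType) (K D : set R) (m : nat) (f : formula K m) :
  forall (n : nat) (r : 'I_m -> 'I_n),
  exists f' : formula K n, forall x, sat D x f' <-> sat D (x \o r) f.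
Proof.
(* Under a quantifier the renaming must fix the bound variable 0 and shift the others. *)
pose lift_map n p (r : 'I_n -> 'I_p) (i : 'I_n.+1) : 'I_p.+1 :=
  if unlift ord0 i is Some j then lift ord0 (r j) else ord0.
have sconsr n p (r : 'I_n -> 'I_p) (a : K) (x : 'I_p -> K) :
    scons a x \o lift_map _ _ r = scons a (x \o r).
  apply/funext => i; rewrite /= /lift_map /scons.
  by case: (unliftP ord0 i) => [j _|_]; rewrite ?liftK ?unlift_none.
elim: f => {m} [m t1 t2|m t1 t2|m t|m g IH|m g IHg h IHh|m g IHg h IHh
  |m g IH|m g IH] n r.
- have [t1' h1] := reindex_eval r t1; have [t2' h2] := reindex_eval r t2.
  by exists (FEq t1' t2') => x /=; rewrite h1 h2.
- have [t1' h1] := reindex_eval r t1; have [t2' h2] := reindex_eval r t2.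
  by exists (FLt t1' t2') => x /=; rewrite h1 h2.
- by have [t' ht] := reindex_eval r t; exists (FPred t') => x /=; rewrite ht.
- by have [g' hg] := IH n r; exists (FNot g') => x /=; rewrite hg.
- have [g' hg] := IHg n r; have [h' hh] := IHh n r.
  by exists (FAnd g' h') => x /=; rewrite hg hh.
- have [g' hg] := IHg n r; have [h' hh] := IHh n r.
  by exists (FOr g' h') => x /=; rewrite hg hh.
- have [g' hg] := IH n.+1 (lift_map _ _ r).
  exists (FExists g') => x /=.
  by split=> -[a ha]; exists a; move: ha; rewrite hg sconsr.
- have [g' hg] := IH n.+1 (lift_map _ _ r).
  exists (FForall g') => x /=.
  by split=> ha a; have := ha a; rewrite hg sconsr.
Qed.

Lemma term_fun_var (R : realType) (K : set R) (n : nat) (i : 'I_n) :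
  term_fun (fun x : 'I_n -> K => val (x i)).
Proof. by exists (TVar _ i). Qed.

Lemma term_fun_param (R : realType) (K : set R) (n : nat) (c : R) :
  K c -> term_fun (fun _ : 'I_n -> K => c).
Proof. by move=> Kc; exists (TParam _ (exist _ c (mem_set Kc))). Qed.

Lemma term_fun0 (R : realType) (K : set R) (n : nat) :
  term_fun (fun _ : 'I_n -> K => 0).
Proof. by exists (TZero _ _). Qed.

Lemma term_fun1 (R : realType) (K : set R) (n : nat) :
  term_fun (fun _ : 'I_n -> K => 1).
Proof. by exists (TOne _ _). Qed.

Lemma term_funD (R : realType) (K : set R) (n : nat)
    (u v : ('I_n -> K) -> R) :
  term_fun u -> term_fun v -> term_fun (fun x => u x + v x).
Proof. by move=> [s hs] [t ht]; exists (TAdd s t) => x /=; rewrite hs ht. Qed.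

Lemma term_funN (R : realType) (K : set R) (n : nat) (u : ('I_n -> K) -> R) :
  term_fun u -> term_fun (fun x => - u x).
Proof. by move=> [s hs]; exists (TOpp s) => x /=; rewrite hs. Qed.

Lemma term_funM (R : realType) (K : set R) (n : nat)
    (u v : ('I_n -> K) -> R) :
  term_fun u -> term_fun v -> term_fun (fun x => u x * v x).
Proof. by move=> [s hs] [t ht]; exists (TMul s t) => x /=; rewrite hs ht. Qed.

Lemma term_fun_lift (R : realType) (K : set R) (n : nat)
    (u : ('I_n -> K) -> R) :
  term_fun u ->
  term_fun (fun x : 'I_n.+1 -> K => u (fun i => x (lift ord0 i))).
Proof.
move=> [t ht]; have [t' ht'] := reindex_eval (lift ord0) t.
by exists t' => x; rewrite ht' ht.
Qed.

Lemma subfield_ops (R : realType) (K : set R) :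
  divring_closed (mem K) ->
  [/\ forall x, K x -> K (- x), forall x y, K x -> K y -> K (x + y),
      forall x y, K x -> K y -> K (x * y) &
      forall x y, K x -> K y -> K (x / y)].
Proof.
move=> hK.
have KN : GRing.oppr_closed (mem K) by exact: (GRing.divring_closedBM hK).
have [_ KD] : GRing.nmod_closed (mem K) by exact: (GRing.divring_closedBM hK).
have [_ KM] : GRing.mulr_closed (mem K) by exact: (GRing.divring_closedBM hK).
have [_ _ KV] := hK.
split=> [x|x y|x y|x y] /mem_set Kx; [|move/mem_set => Ky ..]; apply/set_mem.
- exact: KN.
- exact: KD.
- exact: KM.
- exact: KV.
Qed.

Lemma subfield_nat (R : realType) (K : set R) (n : nat) :
  divring_closed (mem K) -> K n%:R.
Proof.
move=> hK; have [_ KD _ _] := subfield_ops hK; have [/set_mem K1 KB _] := hK.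
elim: n => [|n IH]; last by rewrite -natr1; exact: KD.
by apply/set_mem; rewrite mulr0n -(subrr 1); apply: KB; exact: mem_set.
Qed.

Lemma term_fun_in (R : realType) (K : set R) (n : nat)
    (u : ('I_n -> K) -> R) :
  divring_closed (mem K) -> term_fun u -> forall x, K (u x).
Proof.
move=> hK [t ht] x; rewrite -ht; have [KN KD KM _] := subfield_ops hK.
elim: t {ht} => [i|c|||s hs t ht|s hs|s hs t ht] /=.
- exact: set_valP.
- exact: set_valP.
- exact: (subfield_nat 0).
- exact: (subfield_nat 1).
- exact: KD.
- exact: KN.
- exact: KM.
Qed.

Lemma definable_eq (R : realType) (K D : set R) (n : nat)
    (u v : ('I_n -> K) -> R) :
  term_fun u -> term_fun v -> definable D [set x | u x = v x].
Proof. by move=> [s hs] [t ht]; exists (FEq s t) => x /=; rewrite hs ht. Qed.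

Lemma definable_lt (R : realType) (K D : set R) (n : nat)
    (u v : ('I_n -> K) -> R) :
  term_fun u -> term_fun v -> definable D [set x | u x < v x].
Proof. by move=> [s hs] [t ht]; exists (FLt s t) => x /=; rewrite hs ht. Qed.

Lemma definable_not (R : realType) (K D : set R) (n : nat)
    (X : set ('I_n -> K)) :
  definable D X -> definable D [set x | ~ X x].
Proof. by move=> [f hf]; exists (FNot f) => x /=; rewrite hf. Qed.

Lemma definable_le (R : realType) (K D : set R) (n : nat)
    (u v : ('I_n -> K) -> R) :
  term_fun u -> term_fun v -> definable D [set x | u x <= v x].
Proof.
move=> [s hs] [t ht]; exists (FNot (FLt t s)) => x /=; rewrite hs ht leNgt.
by split => /negP.
Qed.

Lemma definable_and (R : realType) (K D : set R) (n : nat)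
    (X Y : set ('I_n -> K)) :
  definable D X -> definable D Y -> definable D [set x | X x /\ Y x].
Proof. by move=> [f hf] [g hg]; exists (FAnd f g) => x /=; rewrite hf hg. Qed.

Lemma definable_or (R : realType) (K D : set R) (n : nat)
    (X Y : set ('I_n -> K)) :
  definable D X -> definable D Y -> definable D [set x | X x \/ Y x].
Proof. by move=> [f hf] [g hg]; exists (FOr f g) => x /=; rewrite hf hg. Qed.

Lemma definable_imply (R : realType) (K D : set R) (n : nat)
    (X Y : set ('I_n -> K)) :
  definable D X -> definable D Y -> definable D [set x | X x -> Y x].
Proof.
move=> [f hf] [g hg]; exists (FOr (FNot f) g) => x /=.
by rewrite -hf -hg implyE.
Qed.

(** In place of substituting a term into the formula of [X], a fresh variable is bound and equated
    with [u x]; the witness exists because terms take values in [K]. *)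
Lemma definable_mem (R : realType) (K D X : set R) (n : nat)
    (u : ('I_n -> K) -> R) :
  divring_closed (mem K) -> definable_set K D X -> term_fun u ->
  definable D [set x | X (u x)].
Proof.
move=> hK [f hf] hu; have Ku := term_fun_in hK hu; case: hu => t ht.
have [f' hf'] := reindex_sat D f (fun _ : 'I_1 => ord0 : 'I_n.+1).
have [t' ht'] := reindex_eval (lift ord0) t.
have scons_lift (a : K) (x : 'I_n -> K) : scons a x \o lift ord0 = x.
  by apply/funext => i; rewrite /= sconsS.
exists (FExists (FAnd (FEq (TVar _ ord0) t') f')) => x /=; split.
- move=> Xu; exists (exist _ (u x) (mem_set (Ku x))); split.
    by rewrite scons0 ht' scons_lift ht.
  by apply/hf'/hf; rewrite /= scons0.
- move=> [a []]; rewrite scons0 ht' scons_lift ht => <- /hf'/hf.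
  by rewrite /= scons0.
Qed.

(** Formulas quantify over elements of [K], whereas the sets below use [exists2] over reals; the
    inclusion of [X] in [K] bridges the two. *)
Lemma definable_exists (R : realType) (K D X : set R) (n : nat)
    (P : R -> set ('I_n -> K)) :
  divring_closed (mem K) -> X `<=` K -> definable_set K D X ->
  definable D [set x : 'I_n.+1 -> K |
    P (val (x ord0)) (fun i => x (lift ord0 i))] ->
  definable D [set x | exists2 a, X a & P a x].
Proof.
move=> hK XK hX [f hf].
have [g hg] := definable_mem hK hX (term_fun_var K (ord0 : 'I_n.+1)).
have scons_lift (a : K) (x : 'I_n -> K) :
    (fun i => scons a x (lift ord0 i)) = x.
  by apply/funext => i; rewrite sconsS.
exists (FExists (FAnd g f)) => x /=; split.
- move=> [a Xa Pax]; exists (exist _ a (mem_set (XK _ Xa))).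
  by split; [apply/hg|apply/hf]; rewrite /= scons0 ?scons_lift.
- by move=> [a [/hg + /hf]]; rewrite /= scons0 scons_lift; exists (val a).
Qed.

Lemma definable_forall (R : realType) (K D X : set R) (n : nat)
    (P : R -> set ('I_n -> K)) :
  divring_closed (mem K) -> X `<=` K -> definable_set K D X ->
  definable D [set x : 'I_n.+1 -> K |
    P (val (x ord0)) (fun i => x (lift ord0 i))] ->
  definable D [set x | forall a, X a -> P a x].
Proof.
move=> hK XK hX /definable_not hP.
have := definable_not (definable_exists (P := fun a => [set x | ~ P a x])
  hK XK hX hP).
congr definable; apply/seteqP; split=> x /=.
- by move=> h a Xa; apply: contrapT => nP; apply: h; exists a.
- by move=> h [a /h].
Qed.

Lemma definable_set_self (R : realType) (K D : set R) : definable_set K D D.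
Proof. by exists (FPred (TVar _ ord0)). Qed.

Lemma definable_set_univ (R : realType) (K D : set R) : definable_set K D K.
Proof.
exists (FEq (TZero _ _) (TZero _ _)) => x /=; split=> // _.
exact: set_valP.
Qed.

Ltac definability_step :=
  first
  [ assumption
  | exact: term_fun_var | exact: term_fun0 | exact: term_fun1
  | apply: term_funD | apply: term_funN | apply: term_funM
  | apply: definable_and | apply: definable_or | apply: definable_not
  | apply: definable_lt | apply: definable_le | apply: definable_eq ].

(** * Locally finite sets of reals *)

Definition locally_finite (R : realType) (A : set R) : Prop :=
  forall c : R, finite_set [set x | A x /\ `|x| <= c].

(** Finitely many points of [A] lie near [x], and those other than [x] form a closed set that can be
    cut out. Since [x] is any real, this gives both closedness and discreteness. *)
Lemma locally_finite_nbhs (R : realType) (A : set R) (x : R) :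
  locally_finite A -> exists2 V, nbhs x V & V `&` A `<=` [set x].
Proof.
move=> lfA; pose B := [set y | A y /\ `|y| <= `|x| + 1] `\ x.
have clB : closed B.
  apply: (accessible_finite_set_closed.1 (@hausdorff_accessible _ _)).
    exact: Rhausdorff.
  by apply: sub_finite_set (lfA (`|x| + 1)) => y [].
exists (~` B `&` ball x 1).
  apply: filterI; last exact: nbhsx_ballx.
  by apply: open_nbhs_nbhs; split; [exact: closed_openC|case=> _; apply].
move=> y [[nBy]]; rewrite /ball /= => xy1 Ay.
apply: contrapT => yx; apply: nBy; split=> //; split=> //.
have -> : y = x - (x - y) by lra.
by rewrite (le_trans (ler_normB _ _))// lerD2l ltW.
Qed.

Lemma locally_finite_closed (R : realType) (A : set R) :
  locally_finite A -> closed A.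
Proof.
move=> lfA x clAx; have [V Vx VA] := locally_finite_nbhs x lfA.
by have [y [Ay Vy]] := clAx V Vx; rewrite -(VA y).
Qed.

Lemma locally_finite_discrete (R : realType) (A : set R) :
  locally_finite A -> discrete_set A.
Proof.
move=> lfA x Ax; have [V Vx VA] := locally_finite_nbhs x lfA.
split; first exact: mem_set.
exists V => //; apply/seteqP; split=> // _ ->; split=> //.
exact: nbhs_singleton.
Qed.

(** Cutting [[-c, c]] into cells of length [r] leaves at most one point of [A] per cell: the cell
    index [f] is injective on [A] and bounded. *)
Lemma separated_finite (R : realType) (A : set R) (c r : R) :
  0 < r -> (forall x, A x -> `|x| <= c) ->
  (forall x y, A x -> A y -> x < y -> r <= y - x) -> finite_set A.
Proof.
move=> r0 Ac Ar; pose f (x : R) := Num.truncn ((x + c) / r).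
have f_ge0 x : A x -> 0 <= (x + c) / r.
  move=> /Ac; rewrite ler_norml => /andP[? _].
  by apply: divr_ge0; [lra|exact: ltW].
have lt_f x y : A x -> A y -> x < y -> f x <> f y.
  move=> Ax Ay xy fxy; have rxy := Ar _ _ Ax Ay xy.
  have /andP[h1 _] := truncn_itv (f_ge0 _ Ax).
  have /andP[_ h2] := truncn_itv (f_ge0 _ Ay).
  have : (y + c) / r < (x + c) / r + 1.
    by apply: (lt_le_trans h2); rewrite -/(f y) -fxy -natr1 lerD2r.
  by rewrite -(divff (lt0r_neq0 r0)) -mulrDl ltr_pM2r ?invr_gt0//; lra.
have f_inj : {in A &, injective f}.
  move=> x y /set_mem Ax /set_mem Ay fxy.
  by case: (ltgtP x y) => // xy; [case: (lt_f x y)|case: (lt_f y x)].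
rewrite -(eq_finite_set (inj_card_eq f_inj)).
apply: sub_finite_set (finite_II (Num.truncn ((c + c) / r)).+1).
move=> _ [x Ax <-] /=; rewrite ltnS; apply: le_truncn.
rewrite ler_pM2r ?invr_gt0// lerD2r.
by have := Ac _ Ax; rewrite ler_norml => /andP[].
Qed.

Lemma finite_set_min (R : realType) (A : set R) :
  finite_set A -> A !=set0 -> exists2 m, A m & forall a, A a -> m <= a.
Proof.
move=> /finite_seqP[s ->]; elim: s => [[x]//|x s IH _].
case: s IH => [_|y s IH].
  by exists x => [|a] /=; rewrite ?mem_head// inE => /eqP ->.
have [|m sm hm] := IH; first by exists y => /=; rewrite mem_head.
have [xm|mx] := leP x m.
- exists x => [|a] /=; first by rewrite mem_head.
  by rewrite inE => /orP[/eqP->//|/hm]; exact: le_trans.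
- exists m => [|a] /=; first by rewrite inE; apply/orP; right.
  by rewrite inE => /orP[/eqP->|/hm//]; exact: ltW.
Qed.

(** * The points isolated at scale [1/t] *)

(** Distance at least [1/t] is split into two one-sided conditions and multiplied out, which makes
    it a formula without absolute value or division. *)
Definition sep_part (R : realType) (D : set R) (t : R) : set R :=
  [set d | D d /\ - t <= d /\ d <= t /\
    forall e, D e ->
      (e < d -> 1 <= t * (d - e)) /\ (d < e -> 1 <= t * (e - d))].

Lemma sep_part_mono (R : realType) (D : set R) (s t : R) :
  s <= t -> sep_part D s `<=` sep_part D t.
Proof.
move=> st d [Dd [h1 [h2 h3]]]; split=> //; split; first lra.
split; first lra.
move=> e /h3[hl hr]; split=> [ed|de].
- by apply: (le_trans (hl ed)); rewrite ler_wpM2r//; lra.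
- by apply: (le_trans (hr de)); rewrite ler_wpM2r//; lra.
Qed.

Lemma sep_part_finite (R : realType) (D : set R) (t : R) :
  0 < t -> finite_set (sep_part D t).
Proof.
move=> t0; apply: (@separated_finite _ _ t t^-1); first by rewrite invr_gt0.
  by move=> x [_ [h1 [h2 _]]]; rewrite ler_norml h1.
move=> x y [_ [_ [_ hx]]] [Dy _] xy.
have [_ /(_ xy)] := hx y Dy.
by rewrite -[t^-1]mulr1 ler_pdivrMl.
Qed.

Lemma subfield_unbounded (R : realType) (K : set R) (c : R) :
  divring_closed (mem K) -> exists t, [/\ K t, 0 < t & c <= t].
Proof.
move=> hK; exists (Num.truncn `|c|).+1%:R; split.
- exact: subfield_nat.
- by rewrite ltr0n.
- have /andP[_ h] := truncn_itv (normr_ge0 c).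
  by rewrite (le_trans (ler_norm c))// ltW.
Qed.

Lemma sep_part_exhaust (R : realType) (K D : set R) (d : R) :
  divring_closed (mem K) -> discrete_set D -> D d ->
  exists t, [/\ K t, 0 < t & sep_part D t d].
Proof.
move=> hK hD Dd; have [_ [V /nbhs_ballP[e /= e0 eV] VD]] := hD d Dd.
(* With [e] an isolating radius of [d], the bound [|d|] puts [d] in [[-t, t]] and [e^-1] gives
   [1/t <= e]. *)
have [t [Kt t0 ht]] := subfield_unbounded (`|d| + e^-1) hK.
have ei : 0 < e^-1 by rewrite invr_gt0.
have far a : D a -> a != d -> e <= `|d - a|.
  move=> Da ad; rewrite leNgt; apply/negP => dae.
  have : (V `&` D) a by split=> //; exact: eV.
  by rewrite VD /= => /eqP; rewrite (negbTE ad).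
have te : 1 <= t * e by rewrite -ler_pdivrMr// mul1r; have := normr_ge0 d; lra.
have : `|d| <= t by lra.
rewrite ler_norml => /andP[h1 h2].
exists t; split=> //; split=> //; split=> //; split=> // a Da.
split=> ad; apply: (le_trans te); rewrite ler_pM2l//.
- by have := far a Da; rewrite lt_eqF// gtr0_norm ?subr_gt0//; apply.
- by have := far a Da; rewrite gt_eqF// distrC gtr0_norm ?subr_gt0//; apply.
Qed.

(** * Scales *)

(* The distance from a point of [D] to the rest of [D] need not lie in [K]; the
   least gap of the finite set [sep_part D t] always does. *)
Definition scale (R : realType) (K D : set R) : set R :=
  [set y | exists2 t, K t & 0 < t /\ exists2 a, D a & exists2 b, D b &
    sep_part D t a /\ sep_part D t b /\ a < b /\ y * (b - a) = 1 /\
    forall a', D a' -> forall b', D b' ->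
      sep_part D t a' /\ sep_part D t b' /\ a' < b' -> 1 <= y * (b' - a')].

Lemma scale_sub (R : realType) (K D : set R) :
  divring_closed (mem K) -> D `<=` K -> scale K D `<=` K.
Proof.
move=> [K1 KB KV] DK y [t _ [_ [a Da [b Db [_ [_ [ab [yab _]]]]]]]].
have ba : b - a != 0 by rewrite subr_eq0 gt_eqF.
have -> : y = 1 / (b - a) by rewrite -yab mulfK.
by apply/set_mem/KV => //; apply: KB; apply: mem_set; exact: DK.
Qed.

Lemma scale_gt0 (R : realType) (K D : set R) (y : R) : scale K D y -> 0 < y.
Proof.
move=> [t _ [_ [a _ [b _ [_ [_ [ab [yab _]]]]]]]].
by rewrite -(@pmulr_lgt0 _ (b - a)) ?subr_gt0// yab.
Qed.

(** If all gaps were at least [1/c], every bounded part of [D] would be finite by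
    [separated_finite]. The larger of the scales exhausting the two points then serves for both. *)
Lemma close_pair (R : realType) (K D : set R) (c : R) :
  divring_closed (mem K) -> discrete_set D -> ~ locally_finite D -> 0 < c ->
  exists t a b, [/\ K t, 0 < t, sep_part D t a, sep_part D t b
    & a < b /\ c * (b - a) < 1].
Proof.
move=> hK hD /existsNP[C infC] c0.
have [a [b [Da Db ab cab]]] :
    exists a b, [/\ D a, D b, a < b & c * (b - a) < 1].
  apply: contrapT => far; apply: infC.
  apply: (@separated_finite _ _ C c^-1); [by rewrite invr_gt0|by move=> x []|].
  move=> x y [Dx _] [Dy _] xy; rewrite leNgt; apply/negP => lt_xy.
  by apply: far; exists x, y; split=> //; rewrite -ltr_pdivlMl// mulr1.
have [s [Ks s0 sa]] := sep_part_exhaust hK hD Da.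
have [t [Kt t0 tb]] := sep_part_exhaust hK hD Db.
have [st|/ltW ts] := leP s t.
- by exists t, a, b; split=> //; exact: sep_part_mono sa.
- by exists s, a, b; split=> //; exact: sep_part_mono tb.
Qed.

Lemma scale_unbounded (R : realType) (K D : set R) (c : R) :
  divring_closed (mem K) -> discrete_set D -> ~ locally_finite D ->
  exists2 y, scale K D y & c < y.
Proof.
move=> hK hD nlf.
have c0 : 0 < `|c| + 1 by rewrite ltr_wpDl.
have [t [a0 [b0 [Kt t0 sa0 sb0 [ab0 cab0]]]]] := close_pair hK hD nlf c0.
(* The least gap [g] of the finite set [sep_part D t] is attained; its reciprocal is the required
   scale. *)
pose G := [set g | exists a b,
  [/\ sep_part D t a, sep_part D t b, a < b & g = b - a]].
have finG : finite_set G.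
  have finS := sep_part_finite D t0.
  apply: sub_finite_set (finite_image2 (fun a b => b - a) finS finS).
  by move=> g [a [b [sa sb _ ->]]]; exists a => //; exists b.
have [|g [a [b [sa sb ab gE]]] ming] := finite_set_min finG.
  by exists (b0 - a0), a0, b0.
have g0 : 0 < g by rewrite gE subr_gt0.
exists g^-1.
  exists t => //; split=> //; exists a; first by case: sa.
  exists b; first by case: sb.
  split=> //; split=> //; split=> //; split.
    by rewrite -gE mulVf// gt_eqF.
  move=> a' _ b' _ [sa' [sb' ab']].
  by rewrite ler_pdivlMl// mulr1; apply: ming; exists a', b'.
rewrite -[g^-1]mulr1 ltr_pdivlMl//.
have gle : g <= b0 - a0 by apply: ming; exists a0, b0.
apply: le_lt_trans cab0; rewrite mulrC.
have [c_le0|c_gt0] := leP c 0.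
  by apply: (@le_trans _ _ 0); rewrite ?mulr_ge0 ?mulr_le0_ge0//; nra.
by rewrite ler_pM// ?ltW//; have := ler_norm c; lra.
Qed.

(** Fix [s] such that [sep_part D s] has a gap below [1/(|c| + 1)]. Any [t > s] sees this gap and
    gives a scale above [c], so scales up to [c] are reciprocals of gaps in the finite set
    [sep_part D s]. *)
Lemma scale_locally_finite (R : realType) (K D : set R) :
  divring_closed (mem K) -> discrete_set D -> ~ locally_finite D ->
  locally_finite (scale K D).
Proof.
move=> hK hD nlf c.
have c0 : 0 < `|c| + 1 by rewrite ltr_wpDl.
have [s [a0 [b0 [Ks s0 sa0 sb0 [ab0 cab0]]]]] := close_pair hK hD nlf c0.
have finS := sep_part_finite D s0.
apply: sub_finite_set (finite_image2 (fun a b => (b - a)^-1) finS finS).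
move=> y [Fy yc]; have y0 := scale_gt0 Fy.
case: Fy => t _ [_ [a _ [b _ [ta [tb [ab [yab ymin]]]]]]].
have ts : t <= s.
  rewrite leNgt; apply/negP => /ltW st.
  have ta0 := sep_part_mono st sa0; have tb0 := sep_part_mono st sb0.
  have : 1 <= y * (b0 - a0).
    by apply: ymin; [case: ta0|case: tb0|].
  apply/negP; rewrite -ltNge; apply: le_lt_trans cab0.
  rewrite ler_pM2r ?subr_gt0//.
  by have := ler_norm y; have := ler_norm c; lra.
exists a; first exact: sep_part_mono ta.
exists b; first exact: sep_part_mono tb.
apply: (mulIf (x := b - a)); first by rewrite subr_eq0 gt_eqF.
by rewrite yab mulVf// subr_eq0 gt_eqF.
Qed.

(** * Consecutive scales *)

Definition consecutive (R : realType) (F : set R) (y w : R) : Prop :=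
  y < w /\ forall v, F v -> v <= y \/ w <= v.

(** No point of [F] lies strictly inside a gap, so distinct intervals [[y, w)] are disjoint. This is
    how [z] determines its affine map. *)
Lemma consecutive_uniq (R : realType) (F : set R) (y w y' w' z : R) :
  F y -> F w -> F y' -> F w' -> consecutive F y w -> consecutive F y' w' ->
  y <= z < w -> y' <= z < w' -> y = y' /\ w = w'.
Proof.
move=> Fy Fw Fy' Fw' [yw h] [yw' h'] /andP[yz zw] /andP[yz' zw'].
have := h _ Fy'; have := h _ Fw'; have := h' _ Fy; have := h' _ Fw.
by split; lra.
Qed.

(** Some scale [w0] exceeds [y], and only finitely many lie in [(y, w0]]; the least of them is
    [w]. *)
Lemma next_scale (R : realType) (K D : set R) (y : R) :
  divring_closed (mem K) -> discrete_set D -> ~ locally_finite D ->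
  exists2 w, scale K D w & consecutive (scale K D) y w.
Proof.
move=> hK hD nlf; have [w0 Fw0 yw0] := scale_unbounded y hK hD nlf.
pose C := [set v | (scale K D v /\ `|v| <= w0) /\ y < v].
have w0_gt0 := scale_gt0 Fw0.
have finC : finite_set C.
  by apply: sub_finite_set (scale_locally_finite hK hD nlf w0) => v [].
have [|w [[Fw ww0] yw] wmin] := finite_set_min finC.
  by exists w0; split=> //; split=> //; rewrite gtr0_norm.
exists w => //; split=> // v Fv.
have [vy|yv] := leP v y; [by left|right].
have [vw0|w0v] := leP v w0.
- by apply: wmin; split=> //; split=> //; rewrite gtr0_norm// (scale_gt0 Fv).
- by have := ler_norm w; lra.
Qed.

(** * The closed discrete set *)

(* [z] is the image of [d] under the increasing affine bijection from
   [-y, y + 1) onto [y, w), cleared of denominators. *)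
Definition code (R : realType) (y w d z : R) : Prop :=
  (y + y + 1) * (z - y) = (w - y) * (d + y).

Lemma codeE (R : realType) (y w d z : R) :
  0 < y -> code y w d z <-> z = y + (w - y) * (d + y) / (y + y + 1).
Proof.
move=> y0; have p : y + y + 1 != 0 by rewrite gt_eqF//; lra.
rewrite /code; split=> [<-|->].
- by rewrite mulrC mulKf//; lra.
- by rewrite [_ + _ - y]addrAC subrr add0r mulrC divfK.
Qed.

(** The source interval has length [2y + 1], while [d + y <= 2y]; the extra 1 keeps [z] strictly
    below [w]. *)
Lemma code_bounds (R : realType) (y w d z : R) :
  0 < y -> y < w -> - y <= d -> d <= y -> code y w d z -> y <= z < w.
Proof.
rewrite /code => y0 yw dl du h.
have p : 0 < y + y + 1 by lra.
have : 0 <= (y + y + 1) * (z - y) by rewrite h mulr_ge0; lra.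
rewrite pmulr_rge0// subr_ge0 => ->/=.
have : (y + y + 1) * (z - y) < (y + y + 1) * (w - y).
  by rewrite h mulrC ltr_pM2r; lra.
by rewrite ltr_pM2l//; lra.
Qed.

Lemma code_inj (R : realType) (y w d d' z : R) :
  y < w -> code y w d z -> code y w d' z -> d = d'.
Proof.
rewrite /code => yw -> /(mulfI _) h; apply: (addIr y); apply: h.
by rewrite subr_eq0 gt_eqF.
Qed.

(** A code determines its point, but a point has one code for every scale [y] with [d] in
    [sep_part D y]. *)
Definition codes (R : realType) (K D : set R) (z d : R) : Prop :=
  exists2 y, scale K D y & exists2 w, scale K D w &
    consecutive (scale K D) y w /\ sep_part D y d /\ code y w d z.

Definition coded_set (R : realType) (K D : set R) : set R :=
  [set z | scale K D (- z) \/ exists2 d, D d & codes K D z d].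

Lemma codes_gt0 (R : realType) (K D : set R) (z d : R) :
  codes K D z d -> 0 < z.
Proof.
move=> [y Fy [w Fw [[yw _] [[_ [dl [du _]]] h]]]].
have /andP[yz _] := code_bounds (scale_gt0 Fy) yw dl du h.
exact: lt_le_trans (scale_gt0 Fy) yz.
Qed.

(** The point [d] is only assumed to solve the affine equation, not to lie in [D]: decoding uses
    this to prove that [d] is in [D]. *)
Lemma codes_uniq (R : realType) (K D : set R) (y w d d' z : R) :
  scale K D y -> scale K D w -> consecutive (scale K D) y w ->
  y <= z < w -> code y w d z -> codes K D z d' -> d = d'.
Proof.
move=> Fy Fw yw yzw h [y' Fy' [w' Fw' [yw' [[_ [dl [du _]]] h']]]].
have yzw' := code_bounds (scale_gt0 Fy') yw'.1 dl du h'.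
have [yE wE] := consecutive_uniq Fy Fw Fy' Fw' yw yw' yzw yzw'.
by move: h'; rewrite -yE -wE; apply: code_inj h; exact: yw.1.
Qed.

Lemma codes_inj (R : realType) (K D : set R) (d d' z : R) :
  codes K D z d -> codes K D z d' -> d = d'.
Proof.
move=> [y Fy [w Fw [yw [[_ [dl [du _]]] h]]]].
exact: (codes_uniq Fy Fw yw (code_bounds (scale_gt0 Fy) yw.1 dl du h) h).
Qed.

(** Codes are positive and negated scales negative, so the sign separates them and the scales are
    definable from the coded set. *)
Lemma scale_coded_set (R : realType) (K D : set R) :
  scale K D = [set y | 0 < y /\ coded_set K D (- y)].
Proof.
apply/seteqP; split=> y /=.
  by move=> Fy; split; [exact: scale_gt0 Fy|left; rewrite opprK].
by move=> [y0 [|[d _ /codes_gt0]]]; [rewrite opprK|lra].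
Qed.

Lemma codes_total (R : realType) (K D : set R) (d : R) :
  divring_closed (mem K) -> discrete_set D -> ~ locally_finite D -> D d ->
  exists z, codes K D z d.
Proof.
move=> hK hD nlf Dd; have [t [Kt t0 td]] := sep_part_exhaust hK hD Dd.
have [y Fy /ltW ty] := scale_unbounded t hK hD nlf.
have [w Fw yw] := next_scale y hK hD nlf.
(* Any scale [y] above [t] works, since [sep_part D y] then contains [d]. *)
exists (y + (w - y) * (d + y) / (y + y + 1)), y => //; exists w => //.
split=> //; split; first exact: sep_part_mono td.
exact/codeE/erefl/(scale_gt0 Fy).
Qed.

Lemma coded_set_sub (R : realType) (K D : set R) :
  divring_closed (mem K) -> D `<=` K -> coded_set K D `<=` K.
Proof.
move=> hK DK z; have FK := scale_sub hK DK.
have [KN KD KM KV] := subfield_ops hK.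
case=> [/FK/KN|[d /DK Kd [y Fy [w Fw [_ [_ h]]]]]]; first by rewrite opprK.
have [Ky Kw] := (FK _ Fy, FK _ Fw); have y0 := scale_gt0 Fy.
move/(codeE _ _ _ y0): h => ->.
have K1 : K 1 := subfield_nat 1 hK.
apply: (KD _ _ Ky); apply: KV; last by apply: (KD _ _ _ K1); exact: KD.
by apply: KM; apply: KD => //; exact: KN.
Qed.

(** Let [w0] be a scale above [c]. A code up to [c] comes from [y < w0], hence from [w <= w0] and a
    point of [sep_part D w0]: finitely many triples. *)
Lemma coded_set_locally_finite (R : realType) (K D : set R) :
  divring_closed (mem K) -> discrete_set D -> ~ locally_finite D ->
  locally_finite (coded_set K D).
Proof.
move=> hK hD nlf c; have lfF := scale_locally_finite hK hD nlf.
have [w0 Fw0 cw0] := scale_unbounded c hK hD nlf.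
have w0_gt0 := scale_gt0 Fw0.
pose S := [set y | scale K D y /\ `|y| <= w0].
pose z_of (p : R * R) d := p.1 + (p.2 - p.1) * (d + p.1) / (p.1 + p.1 + 1).
have finS : finite_set S := lfF w0.
have finz := finite_image2 z_of (finite_setX finS finS)
  (sep_part_finite D w0_gt0).
have finNS := finite_image -%R finS.
apply: sub_finite_set (_ : finite_set (_ `|` _)); last first.
  by rewrite finite_setU; split; [exact: finNS|exact: finz].
move=> z [[Fz|[d Dd [y Fy [w Fw [yw [yd h]]]]]] zc].
  by left; exists (- z); rewrite ?opprK//; split=> //; rewrite normrN; lra.
right.
have y0 := scale_gt0 Fy; have wpos := scale_gt0 Fw.
have [_ [dl [du _]]] := yd.
have /andP[yz zw] := code_bounds y0 yw.1 dl du h.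
have zpos := ler_norm z.
have yw0 : y < w0 by lra.
(* As [w0] is itself a scale above [y], the successor [w] of [y] cannot pass it. *)
have ww0 : w <= w0 by case: (yw.2 _ Fw0) => //; lra.
exists (y, w).
  by split; split=> //=; rewrite gtr0_norm//; lra.
exists d; first exact: sep_part_mono (ltW yw0) _ yd.
exact/esym/codeE.
Qed.

(** * Definability *)

Lemma definable_sep_part (R : realType) (K D : set R) (n : nat)
    (u v : ('I_n -> K) -> R) :
  divring_closed (mem K) -> D `<=` K -> term_fun u -> term_fun v ->
  definable D [set x | sep_part D (u x) (v x)].
Proof.
move=> hK DK hu hv; have hD := @definable_set_self R K D.
have hu1 := term_fun_lift hu; have hv1 := term_fun_lift hv.
apply: definable_and; first exact: definable_mem.
apply: definable_and; first by repeat definability_step.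
apply: definable_and; first by repeat definability_step.
apply: (definable_forall hK DK hD) => /=.
by apply: definable_and; apply: definable_imply; repeat definability_step.
Qed.

Lemma definable_scale (R : realType) (K D : set R) :
  divring_closed (mem K) -> D `<=` K -> definable_set K D (scale K D).
Proof.
move=> hK DK; have hD := @definable_set_self R K D.
have hU := @definable_set_univ R K D.
apply: (definable_exists hK (@subset_refl _ K) hU) => /=.
apply: definable_and; first by repeat definability_step.
apply: (definable_exists hK DK hD) => /=.
apply: (definable_exists hK DK hD) => /=.
do 2?[apply: definable_and; first by apply: definable_sep_part => //;
  exact: term_fun_var].
do 2?[apply: definable_and; first by repeat definability_step].
apply: (definable_forall hK DK hD) => /=.
apply: (definable_forall hK DK hD) => /=.
apply: definable_imply; last by repeat definability_step.
do 2?[apply: definable_and; first by apply: definable_sep_part => //;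
  exact: term_fun_var].
by repeat definability_step.
Qed.

Lemma definable_consecutive (R : realType) (K D F : set R) (n : nat)
    (u v : ('I_n -> K) -> R) :
  divring_closed (mem K) -> F `<=` K -> definable_set K D F ->
  term_fun u -> term_fun v -> definable D [set x | consecutive F (u x) (v x)].
Proof.
move=> hK FK hF hu hv.
have hu1 := term_fun_lift hu; have hv1 := term_fun_lift hv.
apply: definable_and; first by repeat definability_step.
by apply: (definable_forall hK FK hF) => /=; repeat definability_step.
Qed.

Lemma definable_code (R : realType) (K D : set R) (n : nat)
    (y w d z : ('I_n -> K) -> R) :
  term_fun y -> term_fun w -> term_fun d -> term_fun z ->
  definable D [set x | code (y x) (w x) (d x) (z x)].
Proof. by move=> *; rewrite /code; repeat definability_step. Qed.

Lemma definable_codes (R : realType) (K D : set R) (n : nat)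
    (z d : ('I_n -> K) -> R) :
  divring_closed (mem K) -> D `<=` K -> term_fun z -> term_fun d ->
  definable D [set x | codes K D (z x) (d x)].
Proof.
move=> hK DK hz hd; have FK := scale_sub hK DK.
have hF := definable_scale hK DK.
have hz2 := term_fun_lift (term_fun_lift hz).
have hd2 := term_fun_lift (term_fun_lift hd).
apply: (definable_exists hK FK hF) => /=.
apply: (definable_exists hK FK hF) => /=.
apply: definable_and.
  by apply: definable_consecutive => //; exact: term_fun_var.
apply: definable_and.
  by apply: definable_sep_part => //; exact: term_fun_var.
by apply: definable_code => //; exact: term_fun_var.
Qed.

Lemma definable_coded_set (R : realType) (K D : set R) :
  divring_closed (mem K) -> D `<=` K -> definable_set K D (coded_set K D).
Proof.
move=> hK DK; apply: definable_or.
  apply: (definable_mem hK (definable_scale hK DK)).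
  by repeat definability_step.
apply: (definable_exists hK DK (@definable_set_self R K D)) => /=.
by apply: definable_codes => //; exact: term_fun_var.
Qed.

(** The condition [sep_part D y d] is replaced by [y <= z < w], so that only the coded set and the
    scales are mentioned. A positive [z] in the coded set is a code of some point of [D], which by
    [codes_uniq] equals [d]. *)
Lemma decode_coded_set (R : realType) (K D : set R) :
  divring_closed (mem K) -> discrete_set D -> ~ locally_finite D ->
  D = [set d | exists2 z, coded_set K D z & exists2 y, scale K D y &
    exists2 w, scale K D w & consecutive (scale K D) y w /\
      y <= z /\ z < w /\ code y w d z].
Proof.
move=> hK hD nlf; apply/seteqP; split=> d.
- move=> Dd; have [z zd] := codes_total hK hD nlf Dd.
  exists z; first by right; exists d.
  have [y Fy [w Fw [yw [[_ [dl [du _]]] h]]]] := zd.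
  exists y => //; exists w => //.
  by have /andP[] := code_bounds (scale_gt0 Fy) yw.1 dl du h.
- move=> [z Ez [y Fy [w Fw [yw [yz [zw h]]]]]].
  have yzw : y <= z < w by rewrite yz.
  case: Ez => [/scale_gt0|[d' Dd' zd']]; first by have := scale_gt0 Fy; lra.
  by rewrite (codes_uniq Fy Fw yw yzw h zd').
Qed.

Lemma definable_decode (R : realType) (K D : set R) :
  divring_closed (mem K) -> D `<=` K -> discrete_set D -> ~ locally_finite D ->
  definable_set K (coded_set K D) D.
Proof.
move=> hK DK hD nlf.
(* Only the set to be defined is rewritten; [D] also occurs inside the predicate [coded_set K D]. *)
rewrite [in X in definable_set _ _ X](decode_coded_set hK hD nlf).
have hE := @definable_set_self R K (coded_set K D).
have FK := scale_sub hK DK.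
have hF : definable_set K (coded_set K D) (scale K D).
  rewrite [in X in definable_set _ _ X]scale_coded_set.
  apply: definable_and; first by repeat definability_step.
  by apply: definable_mem => //; repeat definability_step.
apply: (definable_exists hK (coded_set_sub hK DK) hE) => /=.
apply: (definable_exists hK FK hF) => /=.
apply: (definable_exists hK FK hF) => /=.
apply: definable_and.
  by apply: definable_consecutive => //; exact: term_fun_var.
by rewrite /code; repeat definability_step.
Qed.

(** * Construction of [E] and of the surjection onto [D] *)

Theorem theoremB (R : realType) (K : set R) (hK : divring_closed (mem K))
    (D : set R) (hDK : D `<=` K) (hD : discrete_set D) :
  exists E : set R,
    [/\ E `<=` K,
        discrete_set E,
        closed E,
        interdefinable K D E &
        exists g : R -> R,
          [/\ set_fun E D g, set_surj E D g & definable_fun K D E g]].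
Proof.
have hDD := @definable_set_self R K D.
have [lfD|nlf] := pselect (locally_finite D).
  exists D; split=> //; first exact: locally_finite_closed.
  exists id; split=> //; first by move=> d Dd; exists d.
  apply: definable_and; last by repeat definability_step.
  by apply: definable_mem => //; exact: term_fun_var.
have lfE := coded_set_locally_finite hK hD nlf.
exists (coded_set K D); split.
- exact: coded_set_sub.
- exact: locally_finite_discrete.
- exact: locally_finite_closed.
- by split; [exact: definable_coded_set|exact: definable_decode].
(* The empty set is locally finite, so [D] has a point [d0], the value of [g] on the negated
   scales. *)
have [d0 Dd0] : D !=set0.
  apply/set0P/eqP => D0; apply: nlf => c; rewrite D0.
  by apply: sub_finite_set (@finite_set0 R) => x [].
pose g z := xget d0 [set d | codes K D z d].
have gE z d : codes K D z d -> g z = d.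
  by move=> zd; apply: xget_unique => // d' /(codes_inj zd).
have gN z : scale K D (- z) -> g z = d0.
  by move=> /scale_gt0 z0; apply: xgetPN => d /codes_gt0; lra.
exists g; split.
- by move=> z [/gN->//|[d Dd /gE->]].
- move=> d Dd; have [z zd] := codes_total hK hD nlf Dd.
  by exists z; [right; exists d|exact: gE].
rewrite /definable_fun.
(* The graph of [g], defined by choice, is rewritten as a union over the two halves of [E], with
   [d0] as a parameter. *)
have -> : [set x : 'I_2 -> K | coded_set K D (val (x ord0)) /\
      val (x ord_max) = g (val (x ord0))] =
    [set x : 'I_2 -> K |
      scale K D (- val (x ord0)) /\ val (x ord_max) = d0 \/
      codes K D (val (x ord0)) (val (x ord_max))].
  apply/seteqP; split=> x /=.
  - move=> [[Fx|[d Dd xd]] ->]; first by left; rewrite gN.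
    by right; rewrite (gE _ _ xd).
  - move=> [[Fx ->]|xd]; first by rewrite gN//; split=> //; left.
    split; last by rewrite (gE _ _ xd).
    right; exists (val (x ord_max)) => //.
    by have [y _ [w _ [_ [[]]]]] := xd.
apply: definable_or; last by apply: definable_codes => //; exact: term_fun_var.
apply: definable_and.
  apply: (definable_mem hK (definable_scale hK hDK)).
  by repeat definability_step.
by apply: definable_eq; [exact: term_fun_var|apply: term_fun_param; exact: hDK].
Qed.
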